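(* Let $n_X,n_Y,n_B,n_A$ be positive integers. Let $\mathbf q=[q(b|xy)]$ be a behavior of the prepare-and-measure scenario $(n_X;n_Y,n_B)$, and for each $y\in[n_Y]$ let $\mathbf q_y$ be the behavior of the scenario $(n_X;1,n_B)$ defined by $q_y(b|x):=q(b|xy)$. Then $\mathbf q\in \mathrm{NS}^{\mathrm{NA}}(n_X;n_Y,n_B)_{n_A}$ if and only if $\mathbf q_y\in \mathrm{C}(n_X;1,n_B)_{n_A}$ for all $y\in[n_Y]$. That is, $$\mathrm{NS}^{\mathrm{NA}}(n_X;n_Y,n_B)_{n_A}=\{\mathbf q \mid \mathbf q_y\in \mathrm{C}(n_X;1,n_B)_{n_A}\ \forall y\in[n_Y]\}.$$
   Context: For a positive integer $n$, $[n]:=\{0,1,\dots,n-1\}$. Behavior: a behavior of the prepare-and-measure (PM) scenario $(n_X;n_Y,n_B)$ is a family $\mathbf q=[q(b|xy)]$ of real numbers, $b\in[n_B]$, $x\in[n_X]$, $y\in[n_Y]$, with $q(b|xy)\ge 0$ and $\sum_b q(b|xy)=1$ for all $x,y$. When $n_Y=1$ the index $y$ is omitted. Non-signaling (NS) box: for finite input and output sets, a bipartite NS box is a family of conditional probability distributions $p(\alpha\beta|\xi\eta)$ (Alice: input $\xi$, output $\alpha$; Bob: input $\eta$, output $\beta$) such that $\sum_\beta p(\alpha\beta|\xi\eta)$ does not depend on $\eta$ and $\sum_\alpha p(\alpha\beta|\xi\eta)$ does not depend on $\xi$. Classical set: $\mathrm{C}(n_X;n_Y,n_B)_{n_A}$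 is the set of behaviors of $(n_X;n_Y,n_B)$ of the form $q(b|xy)=\sum_{a=0}^{n_A-1}\sum_\lambda \pi(\lambda)\,p(a|x\lambda)\,p(b|ya\lambda)$, where $\lambda$ ranges over a finite set, $\pi$ is a probability distribution, and $p(\cdot|x\lambda)$ on $[n_A]$ and $p(\cdot|ya\lambda)$ on $[n_B]$ are conditional probability distributions. Non-adaptive NS-assisted set: $\mathrm{NS}^{\mathrm{NA}}(n_X;n_Y,n_B)_{n_A}$ is the set of behaviors of $(n_X;n_Y,n_B)$ of the form $q(b|xy)=\sum_{a=0}^{n_A-1}\sum_\beta p(a\beta|xy)\,p(b|a\beta)$, where $p(a\beta|xy)$ is a bipartite NS box (Alice: input $x\in[n_X]$, output $a\in[n_A]$; Bob: input $y\in[n_Y]$, output $\beta$ in some finite set of arbitrary size) and $p(\cdot|a\beta)$ is a conditional probability distribution on $[n_B]$. *)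

(* Defs.v *)
From mathcomp Require Import all_boot all_order all_algebra.
From mathcomp Require Import boolp classical_sets reals.

Set Implicit Arguments.
Unset Strict Implicit.
Unset Printing Implicit Defensive.

Import Order.TTheory GRing.Theory Num.Theory.
Local Open Scope ring_scope.

Definition is_dist (R : realType) (T : finType) (f : T -> R) : Prop :=
  (forall t, 0 <= f t) /\ \sum_(t : T) f t = 1.

(* In every conditional probability the outputs come first and the inputs
   last: [p a b x y] stands for p(ab|xy).                                  *)

(* Real families q(b|xy), b in [nB], x in [nX], y in [nY]; such a family is a
   behavior of the scenario (nX; nY, nB) when [is_behavior] holds.         *)
Definition pm_family (R : realType) (nX nY nB : nat) : Type :=
  'I_nB -> 'I_nX -> 'I_nY -> R.

Definition is_behavior (R : realType) (nX nY nB : nat)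
    (q : pm_family R nX nY nB) : Prop :=
  forall x y, is_dist (fun b => q b x y).

(* q_y(b|x) := q(b|xy); the only input in [1] of the scenario (nX; 1, nB)
   plays the role of the omitted index.                                    *)
Definition slice (R : realType) (nX nY nB : nat)
    (q : pm_family R nX nY nB) (y : 'I_nY) : pm_family R nX 1 nB :=
  fun b x _ => q b x y.

Definition is_NS_box (R : realType) (X Y A B : finType)
    (p : A -> B -> X -> Y -> R) : Prop :=
  [/\ forall x y, is_dist (fun ab : A * B => p ab.1 ab.2 x y),
      forall a x y y', \sum_b p a b x y = \sum_b p a b x y'
    & forall b y x x', \sum_a p a b x y = \sum_a p a b x' y].

Definition classical_set (R : realType) (nX nY nB nA : nat) :
    set (pm_family R nX nY nB) :=
  fun q => is_behavior q /\
  exists (L : finType) (w : L -> R)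
         (pA : 'I_nA -> 'I_nX -> L -> R)
         (pB : 'I_nB -> 'I_nY -> 'I_nA -> L -> R),
    [/\ is_dist w,
        forall x l, is_dist (fun a => pA a x l),
        forall y a l, is_dist (fun b => pB b y a l)
      & forall b x y,
          q b x y = \sum_(a < nA) \sum_(l : L) w l * pA a x l * pB b y a l].

Definition NSNA_set (R : realType) (nX nY nB nA : nat) :
    set (pm_family R nX nY nB) :=
  fun q => is_behavior q /\
  exists (B : finType)
         (p : 'I_nA -> B -> 'I_nX -> 'I_nY -> R)
         (pB : 'I_nB -> 'I_nA -> B -> R),
    [/\ is_NS_box p,
        forall a beta, is_dist (fun b => pB b a beta)
      & forall b x y,
          q b x y = \sum_(a < nA) \sum_(beta : B) p a beta x y * pB b a beta].

Arguments classical_set R nX nY nB nA : clear implicits.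
Arguments NSNA_set R nX nY nB nA : clear implicits.

(* Main.v *)
Require Import Defs.
From mathcomp Require Import all_boot all_order all_algebra.
From mathcomp Require Import boolp classical_sets reals.
From mathcomp Require Import ring.

Import Order.TTheory GRing.Theory Num.Theory.

(** Given an NS box and a fixed [y], Bob's marginal does not depend on [x], so
    his output serves as the shared variable: Alice samples her message
    conditionally on it. Conversely, classical models of the slices have
    different message distributions for different [y]; to make them agree, the
    message is masked by a uniform shift in [Z/nA] known only to Bob (a one-time
    pad). Alice's output is then uniform whatever [y] is, hence no signaling
    from Bob to Alice, and Bob undoes the shift after reading the message. *)

Local Open Scope classical_set_scope.
Local Open Scope ring_scope.

Lemma is_dist_point (R : realType) (T : finType) (t0 : T) :
  is_dist (fun t => (t == t0)%:R : R).
Proof.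
split=> [t|]; first exact: ler0n.
by rewrite (bigD1 t0) //= eqxx big1 ?addr0 // => t /negPf ->.
Qed.

Lemma is_dist_normalize (R : realType) (T : finType) (f : T -> R) :
  (forall t, 0 <= f t) -> \sum_t f t != 0 ->
  is_dist (fun t => f t / \sum_t f t).
Proof.
move=> f0 fn0; split=> [t|].
  by rewrite divr_ge0 // sumr_ge0.
by rewrite -mulr_suml divff.
Qed.

(** Bayes' rule: no-signaling makes Bob's marginal the same for every [x], so [x0] only serves to
    define [w], and [c] is Alice's output conditioned on Bob's. *)
Lemma exists_conditional (R : realType) (A B X : finType) (a0 : A) (x0 : X)
    (p : A -> B -> X -> R) :
  (forall x, is_dist (fun ab : A * B => p ab.1 ab.2 x)) ->
  (forall b x x', \sum_a p a b x = \sum_a p a b x') ->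
  exists (w : B -> R) (c : A -> X -> B -> R),
    [/\ is_dist w,
        forall x b, is_dist (fun a => c a x b)
      & forall a b x, p a b x = w b * c a x b].
Proof.
move=> pdist pns; have p0 a b x : 0 <= p a b x by have [/(_ (a, b))] := pdist x.
pose w b := \sum_a p a b x0.
(* Where [w b] vanishes the conditional is arbitrary; the point mass at [a0] keeps it a
   distribution. *)
exists w, (fun a x b => if w b == 0 then (a == a0)%:R else p a b x / w b).
have wE b x : w b = \sum_a p a b x by exact: pns.
split=> [|x b|a b x].
- split=> [b|]; first exact: sumr_ge0.
  have [_ <-] := pdist x0.
  by rewrite exchange_big -(pair_bigA _ (fun a b => p a b x0)) exchange_big
    /= exchange_big.
- case: eqP => [_|/eqP]; first exact: is_dist_point.
  by rewrite (wE b x); exact: is_dist_normalize.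
- case: eqP => [wb0|/eqP wb0]; last by rewrite mulrC divfK.
  rewrite wb0 mul0r; move: wb0; rewrite (wE b x) => /eqP.
  by rewrite psumr_eq0 // => /allP/(_ a (mem_index_enum a))/eqP.
Qed.

Lemma slice_NSNA_classical (R : realType) (nX nY nB nA : nat)
    (q : pm_family R nX nY nB) (y : 'I_nY) :
  (0 < nX)%N -> (0 < nA)%N ->
  NSNA_set R nX nY nB nA q -> classical_set R nX 1 nB nA (slice q y).
Proof.
move=> hX hA [qb [B [p [pB [[pdist _ pns] pBd qE]]]]].
split=> [x z|]; first exact: qb.
have [w [c [wd cd pE]]] := @exists_conditional R _ B _ (Ordinal hA) (Ordinal hX)
  (fun a b x => p a b x y) (fun x => pdist x y) (fun b => pns b y).
exists B, w, c, (fun b _ a l => pB b a l); split=> // b x z.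
rewrite /slice qE; apply: eq_bigr => a _; apply: eq_bigr => l _.
by rewrite pE.
Qed.

Lemma sum_pick (R : pzSemiRingType) (I : finType) (i0 : I) (F : I -> R) :
  \sum_i (i == i0)%:R * F i = F i0.
Proof.
rewrite (bigD1 i0) //= eqxx mul1r big1 ?addr0 // => i /negPf ->.
by rewrite mul0r.
Qed.

Lemma sum_translate {R : nmodType} {G : finZmodType} (g : G) (F : G -> R) :
  \sum_a F (a - g) = \sum_a F a.
Proof. by rewrite [RHS](reindex_inj (addIr (- g))). Qed.

Lemma sum_reflect {R : nmodType} {G : finZmodType} (g : G) (F : G -> R) :
  \sum_a F (g - a) = \sum_a F a.
Proof. by rewrite [RHS](reindex_inj (subrI g)). Qed.

(** Bob's output [(y, l, s)] records his input, the hidden variable and the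
    shift. *)
Definition masked_box {R : realType} {nX nY n : nat} (L : 'I_nY -> finType)
    (w : forall y, L y -> R) (pA : forall y, 'I_n.+1 -> 'I_nX -> L y -> R)
    (a : 'I_n.+1) (beta : {y : 'I_nY & L y} * 'I_n.+1)
    (x : 'I_nX) (y : 'I_nY) : R :=
  (tag beta.1 == y)%:R *
  (w _ (tagged beta.1) * (n.+1%:R^-1 * pA _ (a - beta.2) x (tagged beta.1))).

(** The indicator keeps only the outputs tagged by the actual input, which removes the dependent
    pair from the sum. *)
Lemma sum_masked {R : realType} {nY : nat} {n : nat}
    (L : 'I_nY -> finType) (F : forall y, L y -> 'I_n.+1 -> R) (y : 'I_nY) :
  \sum_(beta : {y : 'I_nY & L y} * 'I_n.+1)
     (tag beta.1 == y)%:R * F _ (tagged beta.1) beta.2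
  = \sum_l \sum_s F y l s.
Proof.
rewrite -(pair_bigA _ (fun (l : {y : 'I_nY & L y}) s =>
  (tag l == y)%:R * F _ (tagged l) s)) /=.
under eq_bigr do rewrite -mulr_sumr.
rewrite -(@sig_big_dep _ _ _ _ L xpredT (fun _ => xpredT)
  (fun z l => (z == y)%:R * \sum_s F z l s)) /=.
under eq_bigr do rewrite -mulr_sumr.
exact: sum_pick.
Qed.

(** For fixed [a], the unmasked message [a - s] runs over all messages as the shift [s] does, so
    Alice's marginal is uniform. For fixed [beta], summing over [a] exhausts [pA] and removes
    [x]. *)
Lemma masked_box_NS {R : realType} {nX nY n : nat} (L : 'I_nY -> finType)
    (w : forall y, L y -> R) (pA : forall y, 'I_n.+1 -> 'I_nX -> L y -> R) :
  (forall y, is_dist (w y)) ->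
  (forall y x l, is_dist (fun a => pA y a x l)) ->
  is_NS_box (masked_box L w pA).
Proof.
move=> wd pAd.
have sumB a x y : \sum_beta masked_box L w pA a beta x y = n.+1%:R^-1.
  rewrite (sum_masked L
    (fun y l s => w y l * (n.+1%:R^-1 * pA y (a - s) x l))).
  under eq_bigr do rewrite -!mulr_sumr (sum_reflect a (fun t => pA y t x _))
    (pAd y x _).2 mulr1.
  by rewrite -mulr_suml (wd y).2 mul1r.
have sumA beta x y : \sum_a masked_box L w pA a beta x y =
    (tag beta.1 == y)%:R * (w _ (tagged beta.1) * n.+1%:R^-1).
  rewrite /masked_box -!mulr_sumr.
  by rewrite (sum_translate beta.2 (fun t => pA _ t x _)) (pAd _ x _).2 mulr1.
split=> [x y|a x y y'|beta y x x']; last 2 first.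
- by rewrite !sumB.
- by rewrite !sumA.
split=> [[a beta]|] /=.
  rewrite !mulr_ge0 ?ler0n ?invr_ge0 ?ler0n //; first exact: (wd _).1.
  exact: (pAd _ _ _).1.
rewrite -(pair_bigA _ (fun a beta => masked_box L w pA a beta x y)) /=.
under eq_bigr do rewrite sumB.
by rewrite sumr_const card_ord -[_ *+ _]mulr_natr mulVf ?pnatr_eq0.
Qed.

(** Substituting the unmasked message for [a] makes all [n.+1] shifts contribute equally, which
    cancels the factor [n.+1%:R^-1]. *)
Lemma masked_box_decode {R : realType} {nX nY nB n : nat}
    (L : 'I_nY -> finType) (w : forall y, L y -> R)
    (pA : forall y, 'I_n.+1 -> 'I_nX -> L y -> R)
    (pB : forall y, 'I_nB -> 'I_n.+1 -> L y -> R) b x y :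
  \sum_a \sum_beta masked_box L w pA a beta x y *
                   pB _ b (a - beta.2) (tagged beta.1)
  = \sum_a \sum_l w y l * pA y a x l * pB y b a l.
Proof.
transitivity (\sum_(a < n.+1) \sum_l \sum_(s < n.+1)
    w y l * (n.+1%:R^-1 * pA y (a - s) x l) * pB y b (a - s) l).
  apply: eq_bigr => a _.
  rewrite -(sum_masked L (fun y l s =>
    w y l * (n.+1%:R^-1 * pA y (a - s) x l) * pB y b (a - s) l)).
  by apply: eq_bigr => beta _; rewrite /masked_box -mulrA.
rewrite exchange_big [RHS]exchange_big /=; apply: eq_bigr => l _.
(* With [l] and the shift fixed, the inner sum over [a] can be translated. *)
rewrite exchange_big /=.
under eq_bigr do rewrite (sum_translate _ (fun t =>
  w y l * (n.+1%:R^-1 * pA y t x l) * pB y b t l)).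
rewrite sumr_const card_ord -[LHS]mulr_natr mulr_suml.
apply: eq_bigr => a _.
have : n.+1%:R != 0 :> R by rewrite pnatr_eq0.
by move: n.+1%:R => m m0; field.
Qed.

Lemma NSNA_of_classical_slices (R : realType) (nX nY nB nA : nat)
    (q : pm_family R nX nY nB) :
  (0 < nA)%N -> is_behavior q ->
  (forall y, classical_set R nX 1 nB nA (slice q y)) ->
  NSNA_set R nX nY nB nA q.
Proof.
(* Writing [nA] as [n.+1] gives the messages the group structure of integers modulo [n.+1]. *)
case: nA => // n _ qb /all_and2[_].
(* Choose one classical model for each [y]; even the hidden-variable type [L y] depends on [y]. *)
move=> /(_ _)/cid-/all_sig[L] /(_ _)/cid-/all_sig[w].
move=> /(_ _)/cid-/all_sig[pA] /(_ _)/cid-/all_sig[pB].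
move=> /all_and4[wd pAd pBd qE]; split=> //.
exists ({y : 'I_nY & L y} * 'I_n.+1)%type,
  (masked_box L w (fun y a x l => pA y a x l)),
  (* The decoder does not receive [y]; it recovers it from the tag of [beta.1]. Here [ord0] is the
     sole input of the slice. *)
  (fun b a beta => pB _ b ord0 (a - beta.2) (tagged beta.1)); split.
- exact: masked_box_NS.
- by move=> a beta; exact: pBd.
move=> b x y; rewrite (masked_box_decode L w pA (fun y b => pB y b ord0)).
exact: (qE y b x ord0).
Qed.

Theorem mainTheorem1 (R : realType) (nX nY nB nA : nat)
    (hX : (0 < nX)%N) (hY : (0 < nY)%N) (hB : (0 < nB)%N) (hA : (0 < nA)%N) :
  (forall q : pm_family R nX nY nB, is_behavior q ->
     (NSNA_set R nX nY nB nA q <->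
      forall y : 'I_nY, classical_set R nX 1 nB nA (slice q y))) /\
  NSNA_set R nX nY nB nA =
    [set q : pm_family R nX nY nB |
      is_behavior q /\
      forall y : 'I_nY, classical_set R nX 1 nB nA (slice q y)].
Proof.
have H (q : pm_family R nX nY nB) : is_behavior q ->
    (NSNA_set R nX nY nB nA q <->
     forall y : 'I_nY, classical_set R nX 1 nB nA (slice q y)).
  move=> qb; split=> [Hq y|]; first exact: slice_NSNA_classical.
  exact: NSNA_of_classical_slices.
split=> //; apply/seteqP; split=> q /=.
  by move=> Hq; have qb := Hq.1; split=> //; apply/H.
by move=> [qb Hq]; apply/H.
Qed.
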